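(* Let $G$ be a finite group and let $\mathfrak{X}(G)=(G,\{c_g\mid g\in G\})$ be the thin homogeneous coherent configuration defined by $G$. Then there exist natural bijections between the following sets: (1) the set of $\sim$ equivalence classes of weights on $\mathfrak{X}(G)$; (2) the set of $\sim_H$ equivalence classes of H-weights on $\mathfrak{X}(G)$; (3) $\bigcup_{H}H^2(H,\mathbb{C}^\times)$, where $H$ runs over all subgroups of $G$.
   Context: Let $G$ be a finite group and $M_G(\mathbb{C})$ the algebra of complex matrices with rows and columns indexed by $G$. For $g\in G$ put $c_g=\{(x,y)\in G\times G\mid xg=y\}$, and let $C=\{c_g\mid g\in G\}$ and $\mathfrak{X}(G)=(G,C)$. For $c\in C$ let $c^*=\{(y,x)\mid (x,y)\in c\}$, so $c_g^*=c_{g^{-1}}$. Let $A_g\in M_G(\mathbb{C})$ be the $0/1$ matrix with $(A_g)_{x,y}=1$ if and only if $(x,y)\in c_g$. For $W\in M_G(\mathbb{C})$ let $\mathrm{spt}(W)=\{(x,y)\mid W_{xy}\neq 0\}$ and $A_g^W=A_g\circ W$ (entrywise product). For $a_x\in\mathbb{C}$ ($x\in G$), $\mathrm{diag}(a_x\mid x\in G)\in M_G(\mathbb{C})$ is the diagonal matrix with $(x,x)$-entry $a_x$. A matrix $W\in M_G(\mathbb{C})$ is a weight on $\mathfrak{X}(G)$ if: (W1) $\mathrm{spt}(W)$ is a union of members of $C$, and for $d\in C$, $d\subset\mathrm{spt}(W)$ implies $d^*\subset\mathrm{spt}(W)$; (W2) $W_{xx}\neq 0$ for all $x\in G$; (W3)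 $\bigoplus_{g\in G}\mathbb{C}A_g^W$ (the linear span of the $A_g^W$) is an algebra under matrix multiplication. It is an H-weight if moreover (W4) $W$ is hermitian, $|W_{xy}|\in\{0,1\}$ for all $x,y\in G$, and $W_{xx}=1$ for all $x\in G$. Equivalence: let $\mathrm{Aut}(\mathfrak{X}(G))$ be the group of permutations $\sigma$ of the set $G$ with $c^\sigma=c$ for all $c\in C$, where $c^\sigma=\{(x^\sigma,y^\sigma)\mid(x,y)\in c\}$, and let $P_\sigma$ be the permutation matrix corresponding to $\sigma$. Weights $W,W'$ are equivalent, written $W\sim W'$, if there exist $a_x\in\mathbb{C}^\times$ ($x\in G$), $\gamma(g)\in\mathbb{C}^\times$ ($g\in G$) and $\sigma\in\mathrm{Aut}(\mathfrak{X}(G))$ with $$W'=\mathrm{diag}(a_x\mid x\in G)^{-1}P_\sigma^{-1}\Big(\sum_{g\in G}\gamma(g)A_g^W\Big)P_\sigma\,\mathrm{diag}(a_x\mid x\in G).$$ H-weights $W,W'$ are H-equivalent, written $W\sim_H W'$, if this holds with $|a_x|=|\gamma(g)|=1$ for all $x,g\in G$ and $\gamma(g^{-1})=\gamma(g)^{-1}$ for all $g\in G$. For a finite group $H$, a factor set ($2$-cocycle) is a function $\alpha:H\times H\to\mathbb{C}^\times$ with $\alpha(g,h)\alpha(gh,k)=\alpha(g,hk)\alpha(h,k)$ for all $g,h,k\in H$ (trivial action of $H$ on $\mathbb{C}^\times$). The factor sets form an abelian group $Z^2(H,\mathbb{C}^\times)$ under pointwise multiplication; the $2$-coboundaries, i.e.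 the functions $(g,h)\mapsto\gamma(g)\gamma(h)\gamma(gh)^{-1}$ for maps $\gamma:H\to\mathbb{C}^\times$, form a subgroup $B^2(H,\mathbb{C}^\times)$; and $H^2(H,\mathbb{C}^\times)=Z^2(H,\mathbb{C}^\times)/B^2(H,\mathbb{C}^\times)$ is the $2$-cohomology group of $H$. *)

(* Defs.v *)
From HB Require Import structures.
From mathcomp Require Import all_boot all_order all_algebra all_fingroup.
From mathcomp Require Import sesquilinear complex.
From mathcomp Require Import boolp classical_sets functions reals.

Set Implicit Arguments.
Unset Strict Implicit.
Unset Printing Implicit Defensive.

Import Order.TTheory GRing.Theory Num.Theory.
Local Open Scope ring_scope.
Local Open Scope complex_scope.

Section Configuration.
Variable gT : finGroupType.

Definition c_ (g : gT) : {set gT * gT} := [set p | (p.1 * g)%g == p.2]%SET.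

Definition thin_config : {set {set gT * gT}} := [set c_ g | g : gT]%SET.

Definition converse (c : {set gT * gT}) : {set gT * gT} :=
  [set (p.2, p.1) | p in c]%SET.

Definition aut_config : {set {perm gT}} :=
  [set s : {perm gT} |
    [forall c in thin_config, [set (s p.1, s p.2) | p in c] == c]]%SET.

End Configuration.

(* C is R[i] for a realType R.  M_G(C) is the library's 'M_#|gT|; its rows and
   columns are indexed by gT through enum_rank / enum_val. *)
Section Weights.
Variables (R : realType) (gT : finGroupType).
Local Notation C := R[i].
Local Notation MG := 'M[C]_#|gT|.
Implicit Types (W : MG) (x y g h : gT) (a gamma : gT -> C) (s : {perm gT}).

Definition ent W x y : C := W (enum_rank x) (enum_rank y).

Definition mxG (f : gT -> gT -> C) : MG :=
  \matrix_(i, j) f (enum_val i) (enum_val j).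

Definition A_ g : MG := mxG (fun x y => ((x, y) \in c_ g)%:R).

Definition AW W g : MG := map2_mx *%R (A_ g) W.

Definition diagG a : MG := diag_mx (\row_i a (enum_val i)).

Definition permG s : MG := mxG (fun x y => (s x == y)%:R).

Definition spt W : {set gT * gT} := [set p | ent W p.1 p.2 != 0]%SET.

Definition AW_span W : {vspace MG} := <<[seq AW W g | g : gT]>>%VS.

(* In (W3) only closure under products is required: (W2) and closure already
   give W_xx = W_yy for all x, y, so the span contains the identity matrix. *)
Definition is_weight W : Prop :=
  [/\ (exists2 D : {set {set gT * gT}},
         D \subset thin_config gT & spt W = finset.cover D)
      /\ (forall d, d \in thin_config gT ->
            d \subset spt W -> converse d \subset spt W),
      (forall x, ent W x x != 0)
    & (forall A B : MG,
         A \in AW_span W -> B \in AW_span W -> A *m B \in AW_span W)].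

Definition is_Hweight W : Prop :=
  [/\ is_weight W, W \is hermsymmx,
      (forall x y, `|ent W x y| = 0 \/ `|ent W x y| = 1)
    & (forall x, ent W x x = 1)].

Definition transform a gamma s W : MG :=
  invmx (diagG a) *m invmx (permG s) *m (\sum_g gamma g *: AW W g)
    *m permG s *m diagG a.

Definition weight_equiv W W' : Prop :=
  exists a gamma s,
    [/\ forall x, a x != 0, forall g, gamma g != 0,
        s \in aut_config gT & W' = transform a gamma s W].

Definition Hweight_equiv W W' : Prop :=
  exists a gamma s,
    [/\ forall x, `|a x| = 1, forall g, `|gamma g| = 1,
        forall g, gamma g^-1%g = (gamma g)^-1,
        s \in aut_config gT & W' = transform a gamma s W].

Definition weight_class W : set MG :=
  [set W' | is_weight W' /\ weight_equiv W W']%classic.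

Definition Hweight_class W : set MG :=
  [set W' | is_Hweight W' /\ Hweight_equiv W W']%classic.

Definition weight_classes : set (set MG) :=
  [set weight_class W | W in is_weight]%classic.

Definition Hweight_classes : set (set MG) :=
  [set Hweight_class W | W in is_Hweight]%classic.

End Weights.

Section Cohomology.
Variables (R : realType) (hT : finGroupType).
Local Notation C := R[i].
Local Notation cochain2 := {ffun hT * hT -> C}.

Definition Z2 : set cochain2 :=
  [set al | (forall p, al p != 0) /\
    forall g h k : hT,
      al (g, h) * al ((g * h)%g, k) = al (g, (h * k)%g) * al (h, k)]%classic.

Definition coboundary (gamma : hT -> C) : cochain2 :=
  [ffun p => gamma p.1 * gamma p.2 * (gamma (p.1 * p.2)%g)^-1].

Definition B2 : set cochain2 :=
  [set coboundary gamma | gamma in [set ga | forall g, ga g != 0]]%classic.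

Definition cohomology_class (al : cochain2) : set cochain2 :=
  [set [ffun p => al p * be p] | be in B2]%classic.

Definition H2 : set (set cochain2) :=
  [set cohomology_class al | al in Z2]%classic.

End Cohomology.

Section Correspondence.
Variables (R : realType) (gT : finGroupType).
Local Notation C := R[i].
Local Notation MG := 'M[C]_#|gT|.

Definition tagged_classes : Type :=
  {H : {group gT} & set {ffun [subg H] * [subg H] -> C}}.

Definition bigH2 : set tagged_classes :=
  [set u | H2 (projT2 u)]%classic.

(* H is the set of g with A_g^W nonzero, and al holds the structure constants
   of the algebra spanned by the A_g^W, g in H. *)
Definition affords (W : MG) (H : {group gT})
    (al : {ffun [subg H] * [subg H] -> C}) : Prop :=
  [/\ (H : {set gT}) = [set g | c_ g \subset spt W]%SET,
      Z2 al
    & forall g h : [subg H],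
        AW W (sgval g) *m AW W (sgval h)
          = al (g, h) *: AW W (sgval (g * h)%g)].

Definition tagged_class (H : {group gT})
    (al : {ffun [subg H] * [subg H] -> C}) : tagged_classes :=
  existT (fun K : {group gT} => set {ffun [subg K] * [subg K] -> C})
    H (cohomology_class al).

End Correspondence.

(* Main.v *)
(* On the subgroup H of all g with A_g^W <> 0, a weight W satisfies
   W(x,xg) W(xg,xgh) = al(g,h) W(x,xgh) for a factor set al.  Left translations
   and diagonal conjugation preserve al, rescaling by gamma multiplies it by the
   coboundary of gamma.  Conversely, in terms of a representative t of each
   coset xH one has W(x,xg) = al(t^-1 x, g) W(t,xg) / W(t,x), so al determines
   W up to a diagonal conjugation, and putting W(t,-) = 1 realizes any al.
   For H-weights, al is unimodular with al(g,g^-1) = 1; every class contains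
   such an al, and a cochain gamma relating two of them satisfies |gamma| = 1,
   because |gamma| is a homomorphism from a finite group to the positive
   reals. *)
Require Import Defs.
From HB Require Import structures.
From mathcomp Require Import all_boot all_order all_algebra all_fingroup.
From mathcomp Require Import sesquilinear complex.
From mathcomp Require Import boolp classical_sets functions reals.
From mathcomp Require Import ring.

Set Implicit Arguments.
Unset Strict Implicit.
Unset Printing Implicit Defensive.

Import Order.TTheory GRing.Theory Num.Theory.
Local Open Scope ring_scope.
Local Open Scope complex_scope.

(** [inv] is a complete invariant, given as a relation. Its agreement with [E] on [P] makes it
    single-valued and makes [E] an equivalence there, so neither fact is assumed. *)
Lemma class_bij (T U : Type) (u0 : U) (P : set T) (E : T -> T -> Prop)
    (B : set U) (inv : T -> U -> Prop) :
    (forall W, P W -> exists u, inv W u) ->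
    (forall W u, P W -> inv W u -> B u) ->
    (forall W W' u u', P W -> P W' -> inv W u -> inv W' u' ->
       E W W' <-> u = u') ->
    (forall u, B u -> exists2 W, P W & inv W u) ->
  exists f : set T -> U,
    set_bij [set [set W' | P W' /\ E W W'] | W in P]%classic B f
    /\ forall W u, P W -> inv W u -> f [set W' | P W' /\ E W W']%classic = u.
Proof.
move=> inv_ex inv_B invP inv_surj.
pose cl W := [set W' | P W' /\ E W W']%classic.
have E_refl W : P W -> E W W.
  by move=> PW; have [u iu] := inv_ex _ PW; apply/(invP _ _ u u).
(* A value is specified for every set [X], with [u0] where [X] is not a class, so that [choice]
   yields a total function. *)
have fP (X : set T) :
    exists u, forall W v, P W -> inv W v -> X = cl W -> u = v.
  have [[W [PW XW]]|nX] := pselect (exists W, P W /\ X = cl W); last first.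
    by exists u0 => W v PW _ XW; case: nX; exists W.
  have [u iu] := inv_ex _ PW; exists u => W' v PW' iv XW'.
  have [_ EWW'] : cl W W' by rewrite -XW XW'; split=> //; exact: E_refl.
  exact/(invP W W').
have [f fE] := choice fP.
have fcl W u : P W -> inv W u -> f (cl W) = u by move=> PW iu; exact: fE iu _.
exists f; split=> //; split.
- move=> _ [W PW <-]; have [u iu] := inv_ex _ PW.
  by rewrite -/(cl W) (fcl _ _ PW iu); exact: inv_B iu.
- move=> _ _ /set_mem[W PW <-] /set_mem[W' PW' <-]; rewrite -/(cl W) -/(cl W').
  have [u iu] := inv_ex _ PW; have [u' iu'] := inv_ex _ PW'.
  rewrite (fcl _ _ PW iu) (fcl _ _ PW' iu') => uu'; subst u'.
  apply/seteqP; split=> V [PV EV]; split=> //.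
    have [v iv] := inv_ex _ PV.
    by apply/(invP _ _ u v) => //; apply/(invP W V).
  have [v iv] := inv_ex _ PV.
  by apply/(invP _ _ u v) => //; apply/(invP W' V).
- move=> u Bu; have [W PW iu] := inv_surj _ Bu.
  by exists (cl W); [exists W | exact: fcl].
Qed.

(** * Factor sets, coboundaries and unitary representatives *)

Section Cocycles.
Variables (R : realType) (hT : finGroupType).
Local Notation C := R[i].
Implicit Types (al be : {ffun hT * hT -> C}) (ga : hT -> C) (g h k : hT).

Lemma Z2_1l al g : Z2 al -> al (1%g, g) = al (1%g, 1%g).
Proof.
move=> [al0 /(_ 1%g 1%g g)]; rewrite !mul1g => e.
by apply: (mulIf (al0 (1%g, g))); rewrite -e.
Qed.

Lemma Z2_1r al g : Z2 al -> al (g, 1%g) = al (1%g, 1%g).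
Proof.
move=> [al0 /(_ g 1%g 1%g)]; rewrite !mulg1 => e.
by apply: (mulfI (al0 (g, 1%g))).
Qed.

Lemma Z2_inv al g : Z2 al -> al (g^-1%g, g) = al (g, g^-1%g).
Proof.
move=> Zal; have [al0 /(_ g g^-1%g g)] := Zal.
rewrite mulgV mulVg Z2_1l // Z2_1r // mulrC => e.
by apply: (mulfI (al0 (1%g, 1%g))); rewrite e.
Qed.

Lemma cohomology_classP al be :
  cohomology_class al = cohomology_class be <->
  exists2 ga, forall g, ga g != 0
    & forall g h, be (g, h) = al (g, h) * (ga g * ga h * (ga (g * h)%g)^-1).
Proof.
split=> [e|[ga ga0 gaE]].
  have : cohomology_class be be.
    exists (coboundary (fun _ : hT => 1)).
      by exists (fun=> 1) => // g; exact: oner_neq0.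
    by apply/ffunP => p; rewrite !ffunE mulr1 divr1 mulr1.
  by rewrite -e => -[_ [ga ga0 <-] <-]; exists ga => // g h; rewrite !ffunE.
apply/seteqP; split=> _ [_ [de de0 <-] <-].
- exists (coboundary (fun g => de g / ga g)).
    by exists (fun g => de g / ga g) => // g; rewrite mulf_neq0 ?invr_eq0 ?de0.
  apply/ffunP => -[g h]; rewrite !ffunE /= gaE.
  have ? := ga0 g; have ? := ga0 h; have ? := ga0 (g * h)%g.
  have ? := de0 (g * h)%g; field.
  by apply/and4P.
- exists (coboundary (fun g => de g * ga g)).
    by exists (fun g => de g * ga g) => // g; rewrite mulf_neq0 ?ga0 ?de0.
  apply/ffunP => -[g h]; rewrite !ffunE /= gaE.
  have ? := ga0 (g * h)%g; have ? := de0 (g * h)%g; field.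
  by apply/andP.
Qed.

Lemma Z2_mul_coboundary al ga : Z2 al -> (forall g, ga g != 0) ->
  Z2 [ffun p => al p * coboundary ga p].
Proof.
move=> [al0 alM] ga0; split=> [p|g h k]; rewrite !ffunE /=.
  by rewrite !mulf_neq0 ?invr_eq0 ?ga0 ?al0.
rewrite !mulgA; have ? := ga0 (g * h)%g; have ? := ga0 (h * k)%g.
have ? := ga0 (g * h * k)%g.
transitivity (al (g, h) * al ((g * h)%g, k) *
   (ga g * ga h * ga k / ga (g * h * k)%g)); first by field; apply/andP.
by rewrite alM; field; apply/andP.
Qed.

Lemma cohomology_class_mul_coboundary al ga : (forall g, ga g != 0) ->
  cohomology_class [ffun p => al p * coboundary ga p] = cohomology_class al.
Proof.
by move=> ga0; apply/esym/cohomology_classP; exists ga => // g h; rewrite !ffunE.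
Qed.

(** The trace of (W4) on a factor set: unimodular values from $|W_{xy}|=1$ on the support, the value
    at $(1,1)$ from the unit diagonal, the last clause from hermitian symmetry. *)
Definition unitary_cocycle al : Prop :=
  [/\ forall p, `|al p| = 1, al (1%g, 1%g) = 1
    & forall g, al (g, g^-1%g) = 1].

(** Correcting [al] by the coboundary of inverse $n$-th roots of [f], with $n=|hT|$, gives a cocycle
    whose values are $n$-th roots of unity. *)
Lemma Z2_unimodular_rep al : Z2 al ->
  exists be, [/\ Z2 be, forall p, `|be p| = 1
    & cohomology_class be = cohomology_class al].
Proof.
move=> Zal; have [al0 alM] := Zal.
pose n := #|hT|; have n0 : (0 < n)%N by apply/card_gt0P; exists 1%g.
pose f g := \prod_k al (g, k).
have f0 g : f g != 0 by apply/prodf_neq0 => k _; exact: al0.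
(* The product over k of the cocycle identity shows that [al ^+ n] is the
   coboundary of [f]. *)
have fM g h : al (g, h) ^+ n * f (g * h)%g = f g * f h.
  rewrite /f -[_ ^+ n]prodr_const -big_split /=.
  under eq_bigr do rewrite alM.
  rewrite big_split /= [in RHS](reindex_inj (mulgI h)) //.
pose ga g := (n.-root (f g))^-1.
have ga0 g : ga g != 0 by rewrite invr_eq0 rootC_eq0.
have gaX g : ga g ^+ n = (f g)^-1 by rewrite exprVn rootCK.
exists [ffun p => al p * coboundary ga p]; split.
- exact: Z2_mul_coboundary.
- move=> [g h]; apply/eqP; rewrite -(@pexpr_eq1 _ _ n) ?normr_ge0 //.
  rewrite -normrX !ffunE /= !exprMn !gaX exprVn gaX invrK.
  have -> : al (g, h) ^+ n = f g * f h / f (g * h)%g by rewrite -fM mulfK.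
  set z := (X in `|X|); suff -> : z = 1 by rewrite normr1.
  rewrite /z.
  have ? := f0 g; have ? := f0 h; have ? := f0 (g * h)%g; field.
  exact/and3P.
- exact: cohomology_class_mul_coboundary.
Qed.

(** A unimodular representative is corrected by a cochain built from its own values and their square
    roots. That cochain has modulus 1, so unimodularity survives. *)
Lemma Z2_unitary_rep al : Z2 al ->
  exists be, [/\ Z2 be, unitary_cocycle be
    & cohomology_class be = cohomology_class al].
Proof.
move=> /Z2_unimodular_rep[be [Zbe be1 <-]]; have [be0 _] := Zbe.
pose c := be (1%g, 1%g); have c0 : c != 0 by exact: be0.
pose r g := sqrtC (be (g, g^-1%g) / c).
have r0 g : r g != 0 by rewrite sqrtC_eq0 mulf_neq0 ?invr_eq0.
have rV g : r g^-1%g = r g by rewrite /r invgK Z2_inv.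
have r1 : r 1%g = 1 by rewrite /r invg1 divff // sqrtC1.
have normr g : `|r g| = 1.
  apply/eqP; rewrite -(@pexpr_eq1 _ _ 2) ?normr_ge0 // -normrX sqrtCK.
  by rewrite normf_div !be1 divr1.
(* The factor [c] normalizes [be (1, 1)]; [r g] is a function of
   [be (g, g^-1) = be (g^-1, g)], hence [ga g = ga g^-1]. *)
pose ga g := (c * r g)^-1.
have ga0 g : ga g != 0 by rewrite invr_eq0 mulf_neq0.
have normga g : `|ga g| = 1 by rewrite normfV normrM be1 normr mulr1 invr1.
exists [ffun p => be p * coboundary ga p]; split.
- exact: Z2_mul_coboundary.
- split=> [p||g]; rewrite !ffunE /=.
  + by rewrite !normrM !normga normfV normga be1 invr1 !mulr1.
  + by rewrite mulg1 mulfK // /ga r1 mulr1 divff.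
  (* At $(g,g^{-1})$ the coboundary is $(c\,r_g)^{-2}c$, which cancels the value $r_g^2c$ of
     [be]. *)
  + rewrite mulgV /ga rV r1 mulr1 invrK.
    have -> : be (g, g^-1%g) = r g ^+ 2 * c by rewrite sqrtCK divfK.
    by field; apply/andP.
- exact: cohomology_class_mul_coboundary.
Qed.

(** Supplies the conditions on [gamma] in H-equivalence. Taking moduli in the relation makes $|ga|$
    multiplicative, so its value at $g$ has a power equal to 1; the relation at $(g,g^{-1})$ gives
    the inverse rule. *)
Lemma unitary_cochain al be ga :
    unitary_cocycle al -> unitary_cocycle be -> (forall g, ga g != 0) ->
    (forall g h, be (g, h) = al (g, h) * (ga g * ga h * (ga (g * h)%g)^-1)) ->
  (forall g, `|ga g| = 1) /\ forall g, ga g^-1%g = (ga g)^-1.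
Proof.
move=> [al1 al11 alV] [be1 be11 beV] ga0 gaE.
have ga1 : ga 1%g = 1.
  by have := gaE 1%g 1%g; rewrite al11 be11 mul1r mulg1 mulfK.
split=> g; last first.
  have := gaE g g^-1%g; rewrite alV beV mul1r mulgV ga1 divr1 => e.
  by apply: (mulfI (ga0 g)); rewrite -e divff.
have normM h k : `|ga (h * k)%g| = `|ga h| * `|ga k|.
  have := congr1 Num.norm (gaE h k).
  rewrite be1 !normrM al1 mul1r normfV => e.
  by apply/esym/divr1_eq.
have normX m : `|ga (g ^+ m)%g| = `|ga g| ^+ m.
  by elim: m => [|m IH]; rewrite ?expg0 ?ga1 ?normr1 // expgS exprS normM IH.
apply/eqP; rewrite -(@pexpr_eq1 _ _ #[g]%g) ?normr_ge0 ?order_gt0 //.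
by rewrite -normX expg_order ga1 normr1.
Qed.

End Cocycles.

(** * Entrywise calculus for matrices indexed by the group *)

Lemma mulmx1_inv (R : comUnitRingType) (n : nat) (A B : 'M[R]_n) :
  A *m B = 1%:M -> invmx A = B.
Proof.
move=> AB; have [uA _] := mulmx1_unit AB.
by rewrite -[LHS]mulmx1 -AB mulmxA mulVmx // mul1mx.
Qed.

Section WeightEntries.
Variables (R : realType) (gT : finGroupType).
Local Notation C := R[i].
Local Notation MG := 'M[C]_#|gT|.
Implicit Types (W A B : MG) (x y z g h : gT) (a gamma : gT -> C).
Implicit Types (s : {perm gT}) (H : {group gT}).

Lemma mem_c_ g x y : ((x, y) \in c_ g) = (g == (x^-1 * y)%g).
Proof. by rewrite inE /= -(inj_eq (mulgI x^-1%g)) mulKg. Qed.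

Lemma eq_entP A B : (forall x y, ent A x y = ent B x y) -> A = B.
Proof.
move=> e; apply/matrixP => i j.
by rewrite -(enum_valK i) -(enum_valK j); exact: e.
Qed.

Lemma ent_mxG (f : gT -> gT -> C) x y : ent (mxG f) x y = f x y.
Proof. by rewrite /ent mxE !enum_rankK. Qed.

Lemma ent_mul A B x y : ent (A *m B) x y = \sum_z ent A x z * ent B z y.
Proof. by rewrite /ent mxE (reindex _ (onW_bij _ (@enum_rank_bij gT))). Qed.

Lemma ent_sum (I : finType) (F : I -> MG) x y :
  ent (\sum_i F i) x y = \sum_i ent (F i) x y.
Proof. by rewrite /ent summxE. Qed.

Lemma entZ (c : C) A x y : ent (c *: A) x y = c * ent A x y.
Proof. by rewrite /ent mxE. Qed.

Lemma ent_AW W g x y : ent (AW W g) x y = (g == (x^-1 * y)%g)%:R * ent W x y.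
Proof. by rewrite /ent mxE [X in X * _]ent_mxG mem_c_. Qed.

Lemma ent_sum_AW W gamma x y :
  ent (\sum_g gamma g *: AW W g) x y = gamma (x^-1 * y)%g * ent W x y.
Proof.
rewrite ent_sum (bigD1 (x^-1 * y)%g) //= entZ ent_AW eqxx mul1r big1 ?addr0 //.
by move=> g /negPf ne; rewrite entZ ent_AW ne mul0r mulr0.
Qed.

Lemma diagGE a : diagG a = mxG (fun x y => (x == y)%:R * a x).
Proof.
by apply/matrixP => i j; rewrite !mxE (inj_eq enum_val_inj) mulr_natl.
Qed.

Lemma ent_diagG a x y : ent (diagG a) x y = (x == y)%:R * a x.
Proof. by rewrite diagGE ent_mxG. Qed.

Lemma ent_mul_diagG a A x y : ent (A *m diagG a) x y = ent A x y * a y.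
Proof.
rewrite ent_mul (bigD1 y) //= ent_diagG eqxx mul1r big1 ?addr0 // => z /negPf ne.
by rewrite ent_diagG ne mul0r mulr0.
Qed.

Lemma ent_diagG_mul a A x y : ent (diagG a *m A) x y = a x * ent A x y.
Proof.
rewrite ent_mul (bigD1 x) //= ent_diagG eqxx mul1r big1 ?addr0 // => z ne.
by rewrite ent_diagG eq_sym (negPf ne) !mul0r.
Qed.

Lemma ent1 x y : ent (1%:M : MG) x y = (x == y)%:R.
Proof. by rewrite /ent mxE (inj_eq enum_rank_inj). Qed.

Lemma invmx_diagG a : (forall x, a x != 0) ->
  invmx (diagG a) = diagG (fun x => (a x)^-1).
Proof.
move=> a0; apply: mulmx1_inv; apply: eq_entP => x y.
rewrite ent_diagG_mul ent_diagG ent1; case: eqVneq => [->|_] /=.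
  by rewrite mul1r divff.
by rewrite mul0r mulr0.
Qed.

Lemma ent_mul_permG s A x y : ent (A *m permG R s) x y = ent A x (s^-1%g y).
Proof.
rewrite ent_mul (bigD1 (s^-1%g y)) //= ent_mxG permKV eqxx mulr1 big1 ?addr0 //.
move=> z ne; rewrite ent_mxG; case: eqP => [e|_]; last by rewrite mulr0.
by rewrite -e permK eqxx in ne.
Qed.

Lemma ent_permG_mul s A x y : ent (permG R s *m A) x y = ent A (s x) y.
Proof.
rewrite ent_mul (bigD1 (s x)) //= ent_mxG eqxx mul1r big1 ?addr0 //.
by move=> z ne; rewrite ent_mxG eq_sym (negPf ne) mul0r.
Qed.

Lemma invmx_permG s : invmx (permG R s) = permG R s^-1%g.
Proof.
apply: mulmx1_inv; apply: eq_entP => x y.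
by rewrite ent_mul_permG ent_mxG invgK ent1 (inj_eq perm_inj).
Qed.

Lemma ent_transform a gamma s W x y : (forall z, a z != 0) ->
  ent (transform a gamma s W) x y
    = (a x)^-1 * (gamma ((s^-1%g x)^-1 * s^-1%g y)%g
        * ent W (s^-1%g x) (s^-1%g y)) * a y.
Proof.
move=> a0; rewrite /transform invmx_diagG // invmx_permG.
rewrite ent_mul_diagG -!mulmxA ent_diagG_mul ent_permG_mul ent_mul_permG.
by rewrite ent_sum_AW.
Qed.

Lemma aut_config1 : (1%g : {perm gT}) \in aut_config gT.
Proof.
rewrite inE; apply/forallP => c; apply/implyP => _; apply/eqP/setP => -[x y].
apply/imsetP/idP => [[[x' y'] ? [-> ->]]|xy]; first by rewrite !perm1.
by exists (x, y); rewrite ?perm1.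
Qed.

(** Preserving [c_ g] forces [s] to commute with right multiplication by [g]. Hence [s] is a left
    translation and leaves every [x^-1 * y] unchanged. *)
Lemma aut_configM s x g : s \in aut_config gT -> s (x * g)%g = (s x * g)%g.
Proof.
rewrite inE => /forallP/(_ (c_ g))/implyP/(_ (imset_f _ isT))/eqP sc.
have : (s x, s (x * g)%g) \in c_ g.
  rewrite -sc; apply/imsetP; exists (x, (x * g)%g) => //.
  by rewrite inE /=.
by rewrite inE /= => /eqP.
Qed.

Lemma aut_configVM s x g : s \in aut_config gT ->
  s^-1%g (x * g)%g = (s^-1%g x * g)%g.
Proof.
by move=> sG; apply: (@perm_inj _ s); rewrite permKV aut_configM // permKV.
Qed.

Lemma AW_in_span W g : AW W g \in AW_span W.
Proof. by apply/memv_span/map_f/mem_enum. Qed.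

(** Turns (W3) into a statement about entries; [la] is undetermined at those [g] where [AW W g]
    vanishes. *)
Lemma AW_spanP W A :
  A \in AW_span W <->
  exists la : gT -> C, forall x y, ent A x y = la (x^-1 * y)%g * ent W x y.
Proof.
split=> [AX|[la laE]].
  pose X := in_tuple [seq AW W g | g : gT]; rewrite (@coord_span _ _ _ X _ AX).
  pose f (i : nat) := nth 1%g (enum gT) i.
  (* Coordinates are indexed by positions in [enum gT]; the sum selects the one at the position of
     [g]. *)
  exists (fun g => \sum_i coord X i A * (f i == g)%:R) => x y.
  rewrite ent_sum mulr_suml; apply: eq_bigr => -[i ltin] _; rewrite entZ.
  rewrite (nth_map 1%g) -?(size_map (AW W)) // ent_AW mulrA; congr (_ * _ * _).
have -> : A = \sum_g la g *: AW W g by apply: eq_entP => x y; rewrite ent_sum_AW.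
by apply: memv_suml => g _; apply/memvZ/AW_in_span.
Qed.

End WeightEntries.

(** * The subgroup and the factor set of a weight *)

Section FactorSets.
Variables (R : realType) (gT : finGroupType).
Local Notation C := R[i].
Local Notation MG := 'M[C]_#|gT|.
Implicit Types (W A B : MG) (x y z g h : gT) (a gamma : gT -> C).
Implicit Types (s : {perm gT}) (H : {group gT}).

Lemma ent_AW_mul W A g x y :
  ent (AW W g *m A) x y = ent W x (x * g)%g * ent A (x * g)%g y.
Proof.
rewrite ent_mul (bigD1 (x * g)%g) //= ent_AW mulKg eqxx mul1r big1 ?addr0 //.
move=> z nz; rewrite ent_AW; case: (g =P _) => [e|_]; last by rewrite !mul0r.
by rewrite e mulKVg eqxx in nz.
Qed.

(** Entrywise working form of [affords]: [W] is supported on the pairs lying in a common left coset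
    of [H]. The cocycle identity is not part of it but a consequence. The memberships in [H] make
    the uses of [subg] faithful. *)
Definition twisted W H (al : {ffun [subg H] * [subg H] -> C}) : Prop :=
  (forall x y, (ent W x y != 0) = ((x^-1 * y)%g \in H)) /\
  forall x y z, (x^-1 * y)%g \in H -> (y^-1 * z)%g \in H ->
    ent W x y * ent W y z
      = al (subg H (x^-1 * y)%g, subg H (y^-1 * z)%g) * ent W x z.

Lemma sub_spt W g :
  reflect (forall x, ent W x (x * g)%g != 0) (c_ g \subset spt W).
Proof.
apply: (iffP fintype.subsetP) => [sW x|W0 [x y]].
  by have := sW (x, (x * g)%g); rewrite mem_c_ mulKg eqxx inE; apply.
by rewrite mem_c_ inE => /eqP e; have := W0 x; rewrite e mulKVg.
Qed.

Lemma weight_sub_spt W x g : is_weight W ->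
  ent W x (x * g)%g != 0 -> c_ g \subset spt W.
Proof.
move=> [[[D sD sptE] _] _ _] W0.
have : (x, (x * g)%g) \in spt W by rewrite inE.
rewrite sptE => /bigcupP[d dD].
have /imsetP[h _ dh] := fintype.subsetP sD _ dD.
by rewrite dh mem_c_ mulKg => /eqP <-; rewrite -dh; exact: finset.bigcup_sup dD.
Qed.

(** The product of [AW W g] and [AW W h] lives on [c_ (g * h)], so (W3) makes it a scalar multiple
    of [AW W (g * h)]. These scalars form the factor set. *)
Lemma weight_twisted W : is_weight W ->
  exists H (al : {ffun [subg H] * [subg H] -> C}), twisted W al.
Proof.
move=> wW; have [[_ W1] W2 W3] := wW.
have supp x z g : ent W x (x * g)%g != 0 -> ent W z (z * g)%g != 0.
  by move=> /(weight_sub_spt wW)/sub_spt; apply.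
have /choice[nu nuE] (p : gT * gT) : exists nu : C, forall x,
    ent W x (x * p.1)%g * ent W (x * p.1)%g (x * p.1 * p.2)%g
      = nu * ent W x (x * p.1 * p.2)%g.
  have /AW_spanP[la laE] := W3 _ _ (AW_in_span W p.1) (AW_in_span W p.2).
  (* The coefficient depends on the product $gh$ only, hence one scalar serves all rows [x]. *)
  exists (la (p.1 * p.2)%g) => x; have := laE x (x * p.1 * p.2)%g.
  by rewrite ent_AW_mul ent_AW mulKg eqxx mul1r -mulgA mulKg.
pose H0 := [set g | ent W 1%g g != 0]%SET.
have H0E x y : (ent W x y != 0) = ((x^-1 * y)%g \in H0).
  rewrite inE -{1}[y](mulKVg x) -[X in _ = (ent _ _ X != 0)]mul1g.
  by apply/idP/idP; exact: supp.
have gH0 : group_set H0.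
  apply/group_setP; split=> [|g h]; first by rewrite inE.
  (* If $W(1,gh)=0$, then $W(1,g)W(g,gh)=0$ although both factors are nonzero, the second by
     transport of $W(1,h)\neq 0$ to row $g$. *)
  rewrite !inE => g0 h0; apply: contraNneq g0 => gh0.
  have := nuE (g, h) 1%g; rewrite /= !mul1g gh0 mulr0 => /eqP.
  rewrite mulf_eq0 => /orP[//|e]; have := supp 1%g g h.
  by rewrite mul1g h0 e => /(_ isT).
exists (group gH0), [ffun p => nu (sgval p.1, sgval p.2)]; split=> // x y z xy yz.
rewrite ffunE /= !subgK //.
by have := nuE ((x^-1 * y)%g, (y^-1 * z)%g) x; rewrite /= !mulKVg.
Qed.

Section Twisted.
Variables (W : MG) (H : {group gT}) (al : {ffun [subg H] * [subg H] -> C}).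
Hypothesis tW : twisted W al.

Let W_neq0 x y : (x^-1 * y)%g \in H -> ent W x y != 0.
Proof. by move=> xy; rewrite tW.1. Qed.

Let W_eq0 x y : (x^-1 * y)%g \notin H -> ent W x y = 0.
Proof. by rewrite -tW.1 negbK => /eqP. Qed.

Lemma twisted_subg (x : gT) (g h : [subg H]) :
  ent W x (x * sgval g)%g * ent W (x * sgval g)%g (x * sgval g * sgval h)%g
    = al (g, h) * ent W x (x * sgval g * sgval h)%g.
Proof. by rewrite tW.2 !mulKg ?sgvalK ?subgP. Qed.

(** The product $W(1,g)W(g,gh)W(gh,ghk)$ is reduced in two ways to a multiple of the nonzero entry
    $W(1,ghk)$. *)
Lemma twisted_Z2 : Z2 al.
Proof.
have w0 (g : [subg H]) x : ent W x (x * sgval g)%g != 0.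
  by rewrite W_neq0 // mulKg subgP.
have sM (g h : [subg H]) : (sgval g * sgval h)%g = sgval (g * h)%g by [].
split=> [[g h]|g h k].
  have := twisted_subg 1%g g h; apply: contra_eq_neq => ->.
  by rewrite mul0r mulf_neq0 ?w0.
have e1 := twisted_subg 1%g g h; have e2 := twisted_subg 1%g (g * h)%g k.
have e3 := twisted_subg (sgval g) h k; have e4 := twisted_subg 1%g g (h * k)%g.
rewrite !mul1g -?sM ?mulgA in e1 e2 e3 e4.
have w3 : ent W 1%g (sgval g * sgval h * sgval k)%g != 0.
  by have := w0 (g * h * k)%g 1%g; rewrite mul1g.
apply: (mulIf w3); rewrite -mulrA -e2 mulrA -e1.
by rewrite -mulrA e3 mulrCA e4 mulrCA mulrA.
Qed.

Lemma twisted_weight : is_weight W.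
Proof.
split; [split | |].
- exists [set c_ g | g in H]%SET.
    by apply/fintype.subsetP => _ /imsetP[g _ ->]; exact: imset_f.
  apply/setP => -[x y]; rewrite inE tW.1 /=; apply/idP/bigcupP => [xy|].
    by exists (c_ (x^-1 * y)%g); [exact: imset_f | rewrite mem_c_].
  by move=> [_ /imsetP[g gH ->]]; rewrite mem_c_ => /eqP <-.
- move=> _ /imsetP[g _ ->] /sub_spt/(_ 1%g); rewrite tW.1 invg1 !mul1g => gH.
  apply/fintype.subsetP => _ /imsetP[[x y] + ->].
  rewrite mem_c_ inE tW.1 /= => /eqP eg.
  by rewrite -groupV invMg invgK -eg.
- by move=> x; rewrite W_neq0 // mulVg.
- move=> A B /AW_spanP[la laE] /AW_spanP[mu muE]; apply/AW_spanP.
  (* [al] is extended by zero to the whole group; the coefficients of the product are then the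
     twisted convolution of [la] and [mu]. *)
  pose be g h := if (g \in H) && (h \in H) then al (subg H g, subg H h) else 0.
  exists (fun u => \sum_g la g * mu (g^-1 * u)%g * be g (g^-1 * u)%g) => x y.
  rewrite ent_mul (reindex_inj (mulgI x)) /= mulr_suml; apply: eq_bigr => g _.
  rewrite laE muE mulKg invMg -mulgA mulrACA -[RHS]mulrA; congr (_ * _).
  rewrite /be; case: ifP => [/andP[gH hH]|nH].
    by rewrite tW.2 ?mulKg ?invMg -?mulgA.
  rewrite mul0r; move/negbT: nH; rewrite negb_and => /orP[nH|nH].
    by rewrite W_eq0 ?mul0r ?mulKg.
  by rewrite [X in _ * X]W_eq0 ?mulr0 ?invMg -?mulgA.
Qed.

Lemma twisted_affords : affords W al.
Proof.
split; first 1 last; first exact: twisted_Z2.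
- move=> g h; apply: eq_entP => x y; rewrite ent_AW_mul entZ !ent_AW.
  rewrite invMg -mulgA; have -> : sgval (g * h)%g = (sgval g * sgval h)%g by [].
  rewrite -[sgval h == _](inj_eq (mulgI (sgval g))) mulKVg.
  case: eqP => [e|_]; last by rewrite !(mul0r, mulr0).
  by have := twisted_subg x g h; rewrite -mulgA e mulKVg !mul1r.
- apply/setP => g; rewrite inE; apply/idP/sub_spt => [gH x|/(_ 1%g)].
    by rewrite W_neq0 // mulKg.
  by rewrite tW.1 invg1 !mul1g.
Qed.

Lemma twisted_unique (be : {ffun [subg H] * [subg H] -> C}) :
  twisted W be -> al = be.
Proof.
move=> tW'; apply/ffunP => -[g h].
have w0 : ent W 1%g (1 * sgval g * sgval h)%g != 0.
  by rewrite W_neq0 // invg1 !mul1g groupM ?subgP.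
have := tW'.2 1%g (sgval g) (sgval g * sgval h)%g.
rewrite invg1 !mul1g mulKg !subgP !sgvalK => /(_ isT isT) e.
have := twisted_subg 1%g g h; rewrite !mul1g e => /mulIf -> //.
by move: w0; rewrite mul1g.
Qed.

(** Along $x,y,z$ the diagonal factors telescope, and [s] only moves the base points, so [gamma]
    alone changes the factor set. *)
Lemma twisted_transform a gamma s :
    (forall x, a x != 0) -> (forall g, gamma g != 0) -> s \in aut_config gT ->
  twisted (transform a gamma s W)
    [ffun p => al p * coboundary (fun k : [subg H] => gamma (sgval k)) p].
Proof.
move=> a0 gamma0 sG.
have sV x y : ((s^-1%g x)^-1 * s^-1%g y = x^-1 * y)%g.
  by rewrite -{1}[y](mulKVg x) aut_configVM // mulKg.
split=> [x y|x y z xy yz]; rewrite !ent_transform // !sV.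
  rewrite -(sV x y) -tW.1 !mulf_eq0 invr_eq0 !negb_or.
  by rewrite !(a0, gamma0) /= andbT.
have xz : (x^-1 * y * (y^-1 * z) = x^-1 * z)%g by rewrite -mulgA mulKVg.
rewrite !ffunE /= !subgK // xz.
have := tW.2 (s^-1%g x) (s^-1%g y) (s^-1%g z); rewrite !sV => /(_ xy yz) e.
transitivity ((a x)^-1 * gamma (x^-1 * y)%g * gamma (y^-1 * z)%g * a z
  * (ent W (s^-1%g x) (s^-1%g y) * ent W (s^-1%g y) (s^-1%g z))).
  by have ? := a0 x; have ? := a0 y; field; apply/andP.
rewrite e; have ? := a0 x; have ? := gamma0 (x^-1 * z)%g; field.
exact/andP.
Qed.

End Twisted.

Lemma twisted_group W H H' (al : {ffun [subg H] * [subg H] -> C})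
    (al' : {ffun [subg H'] * [subg H'] -> C}) :
  twisted W al -> twisted W al' -> H = H'.
Proof.
move=> [HE _] [HE' _]; apply/val_inj/setP => g /=.
by rewrite -[g]mul1g -[1%g]invg1 -HE HE'.
Qed.

End FactorSets.

(** * Realizing factor sets and comparing weights through coset representatives *)

Section CosetRepresentatives.
Variables (R : realType) (gT : finGroupType) (H : {group gT}).
Local Notation C := R[i].
Local Notation MG := 'M[C]_#|gT|.
Local Notation cochain2 := {ffun [subg H] * [subg H] -> C}.
Implicit Types (W : MG) (x y z g : gT) (al be : cochain2).

Definition coset_rep x : gT := repr (x *: H)%g.

Definition coset_coord x : gT := ((coset_rep x)^-1 * x)%g.

Lemma coset_coord_mem x : coset_coord x \in H.
Proof.
rewrite -groupV /coset_coord invMg invgK -mem_lcoset.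
exact: mem_repr (lcoset_refl H x).
Qed.

Lemma coset_rep_eq x y : (x^-1 * y)%g \in H -> coset_rep y = coset_rep x.
Proof. by rewrite -mem_lcoset /coset_rep => /lcoset_eqP ->. Qed.

Lemma coset_coordM x y : (x^-1 * y)%g \in H ->
  coset_coord y = (coset_coord x * (x^-1 * y))%g.
Proof.
by move=> xy; rewrite /coset_coord (coset_rep_eq xy) -mulgA mulKVg.
Qed.

(** With $t$ the representative of $xH$, the entry is $al(t^{-1}x,x^{-1}y)$. For a cocycle, row $t$
    is therefore constant on its coset, equal to $al(1,1)$, and the relation in [twisted] is the
    cocycle identity at $(t^{-1}x,x^{-1}y,y^{-1}z)$. *)
Definition factor_set_mx al : MG :=
  mxG (fun x y => if (x^-1 * y)%g \in H
                  then al (subg H (coset_coord x), subg H (x^-1 * y)) else 0).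

Lemma twisted_factor_set_mx al : Z2 al -> twisted (factor_set_mx al) al.
Proof.
move=> [al0 alM]; split=> [x y|x y z xy yz]; rewrite !ent_mxG.
  by case: ifP => _; rewrite ?al0 ?eqxx.
have e : (x^-1 * z = (x^-1 * y) * (y^-1 * z))%g by rewrite -mulgA mulKVg.
rewrite xy yz e groupM // (coset_coordM xy).
rewrite (subgM (coset_coord_mem x) xy) (subgM xy yz).
by rewrite alM mulrC.
Qed.

Lemma hermsymmx_entP W :
  reflect (forall x y, ent W x y = (ent W y x)^*%C) (W \is hermsymmx).
Proof.
apply: (iffP (is_hermitianmxP _ _ _)) => [e x y|e].
  by rewrite /ent {1}e expr0 scale1r !mxE.
apply: eq_entP => x y; rewrite e expr0 scale1r.
by rewrite /ent !mxE.
Qed.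

Lemma unitary_Hweight al :
  Z2 al -> unitary_cocycle al -> is_Hweight (factor_set_mx al).
Proof.
move=> Zal [al1 al11 alV]; have tW := twisted_factor_set_mx Zal.
set W := factor_set_mx al in tW *.
have norm01 x y : ent W x y = 0 \/ `|ent W x y| = 1.
  by rewrite ent_mxG; case: ifP => _; [right | left].
have W1 x : ent W x x = 1.
  by rewrite ent_mxG mulVg group1 (morph1 (subg_morphism H)) Z2_1r.
split=> //; first exact: twisted_weight tW.
  apply/hermsymmx_entP => x y.
  have [yx|/eqP] := boolP (ent W y x == 0).
    have /eqP -> : ent W x y == 0.
      by move: yx; apply: contraTT; rewrite !tW.1 -groupV invMg invgK.
    by rewrite (eqP yx) rmorph0.
  move=> yx; have [//|n1] := norm01 y x.
  have yxH : (y^-1 * x)%g \in H by rewrite -tW.1; apply/eqP.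
  have xyH : (x^-1 * y)%g \in H by rewrite -groupV invMg invgK.
  (* $W(y,x)W(x,y)=al(h,h^{-1})=1$ with $h=y^{-1}x$, while $W(y,x)$ times its conjugate is also 1;
     cancelling gives hermitian symmetry. *)
  have := tW.2 y x y yxH xyH; rewrite W1 mulr1.
  have -> : subg H (x^-1 * y) = (subg H (y^-1 * x))^-1%g.
    by rewrite -(morphV (subg_morphism H) yxH) invMg invgK.
  rewrite alV => e; move/eqP in yx; apply: (mulfI yx).
  by rewrite e -normCK n1 expr1n.
by move=> x y; have [->|?] := norm01 x y; [left; rewrite normr0 | right].
Qed.

Lemma Hweight_unitary W al :
  is_Hweight W -> twisted W al -> unitary_cocycle al.
Proof.
move=> [_ /hermsymmx_entP Wh Wn W1] tW.
have n1 x y : (x^-1 * y)%g \in H -> `|ent W x y| = 1.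
  rewrite -tW.1 => /negPf W0; case: (Wn x y) => // /eqP.
  by rewrite normr_eq0 W0.
have mem1 (g : [subg H]) : (1^-1 * sgval g)%g \in H.
  by rewrite invg1 mul1g subgP.
split=> [[g h]||g].
- have := congr1 Num.norm (twisted_subg tW 1%g g h).
  by rewrite !normrM !n1 ?mulr1 // ?mulKg ?subgP // mul1g (mem1 (g * h)%g).
- by have := twisted_subg tW 1%g 1%g 1%g; rewrite !mulg1 !W1 !mulr1.
(* Here $al(g,g^{-1})=W(1,g)W(g,1)=|W(1,g)|^2$. *)
- have := twisted_subg tW 1%g g g^-1%g; rewrite -mulgA -sgvalM ?finset.in_setT //.
  rewrite mulgV !mul1g W1 mulr1 => <-.
  by rewrite [ent W _ 1%g]Wh -normCK n1 // expr1n.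
Qed.

(** [a] is the solution of the transform equation on the rows of the representatives $t$, normalized
    by $a_t=1$; the relations in [twisted] carry the equality to the other rows. The witnesses stay
    explicit because H-equivalence needs their moduli. *)
Lemma twisted_equiv W W' al be (ga : [subg H] -> C) :
    twisted W al -> twisted W' be -> (forall g : [subg H], ga g != 0) ->
    (forall g h : [subg H],
       be (g, h) = al (g, h) * (ga g * ga h * (ga (g * h)%g)^-1)) ->
  let gamma (g : gT) := if g \in H then ga (subg H g) else 1 in
  let a x := ent W' (coset_rep x) x
               / (gamma (coset_coord x) * ent W (coset_rep x) x) in
  (forall x, a x != 0) /\ W' = transform a gamma 1%g W.
Proof.
move=> tW tW' ga0 gaE gamma a.
have gamma0 g : gamma g != 0 by rewrite /gamma; case: ifP; rewrite ?oner_neq0.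
have a0 x : a x != 0.
  by rewrite mulf_neq0 ?invr_eq0 ?mulf_neq0 ?tW.1 ?tW'.1 ?coset_coord_mem.
split=> //; apply: eq_entP => x y; rewrite ent_transform // invg1 !perm1.
have [xy|xy] := boolP ((x^-1 * y)%g \in H); last first.
  have /eqP -> : ent W x y == 0 by rewrite -[_ == 0]negbK tW.1.
  have /eqP -> : ent W' x y == 0 by rewrite -[_ == 0]negbK tW'.1.
  by rewrite !mulr0 mul0r.
have kx := coset_coord_mem x; have ky := coset_coord_mem y.
rewrite /a (coset_rep_eq xy).
have e := tW.2 _ _ _ kx xy; have e' := tW'.2 _ _ _ kx xy.
rewrite -!/(coset_coord x) in e e'.
rewrite gaE -subgM // -(coset_coordM xy) in e'.
have gammaE g : g \in H -> ga (subg H g) = gamma g by rewrite /gamma => ->.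
rewrite !gammaE // in e'.
have u0 : ent W' (coset_rep x) x != 0 by rewrite tW'.1.
have v0 : ent W (coset_rep x) x != 0 by rewrite tW.1.
have v0' : ent W (coset_rep x) y != 0 by rewrite -(coset_rep_eq xy) tW.1.
have p0 := gamma0 (coset_coord x); have r0 := gamma0 (coset_coord y).
apply: (mulfI u0); rewrite e'.
(* Grouping $W(t,x)W(x,y)$ lets [e] replace it by a multiple of $W(t,y)$, after which the factor set
   cancels. *)
transitivity (gamma (coset_coord x) * gamma (x^-1 * y)%g
    / gamma (coset_coord y) * ent W' (coset_rep x) y / ent W (coset_rep x) y
    * (ent W (coset_rep x) x * ent W x y)).
  by rewrite e; field; apply/andP.
by field; apply/and5P.
Qed.

End CosetRepresentatives.

(** * The tagged cohomology class as a complete invariant *)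

Section Classification.
Variables (R : realType) (gT : finGroupType).
Local Notation C := R[i].
Local Notation MG := 'M[C]_#|gT|.
Implicit Types (W : MG) (u : tagged_classes R gT).

Definition has_class W u : Prop :=
  exists (H : {group gT}) (al : {ffun [subg H] * [subg H] -> C}),
    twisted W al /\ u = tagged_class al.

Lemma weight_has_class W : is_weight W -> exists u, has_class W u.
Proof.
by move=> /weight_twisted[H [al tW]]; exists (tagged_class al), H, al.
Qed.

Lemma has_class_bigH2 W u : has_class W u -> bigH2 u.
Proof. by move=> [H [al [tW ->]]]; exists al => //; exact: twisted_Z2 tW. Qed.

Lemma has_class_equiv W W' u u' :
  has_class W u -> has_class W' u' -> weight_equiv W W' -> u = u'.
Proof.
move=> [H [al [tW ->]]] [H' [al' [tW' ->]]] [a [gamma [s [a0 gamma0 sG W'E]]]].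
have := twisted_transform tW a0 gamma0 sG; rewrite -W'E => tW''.
have eH := twisted_group tW'' tW'; subst H'.
rewrite -(twisted_unique tW'' tW') /tagged_class.
by rewrite cohomology_class_mul_coboundary.
Qed.

Lemma has_class_eq W W' u :
    has_class W u -> has_class W' u ->
  exists (H : {group gT}) (al be : {ffun [subg H] * [subg H] -> C})
    (ga : [subg H] -> C),
    [/\ twisted W al, twisted W' be, forall g, ga g != 0
      & forall g h, be (g, h) = al (g, h) * (ga g * ga h * (ga (g * h)%g)^-1)].
Proof.
move=> [H [al [tW ->]]] [H' [be [tW' e]]].
have eH : H = H' := congr1 tag e; subst H'.
have /cohomology_classP[ga ga0 gaE] := eq_from_Tagged e.
by exists H, al, be, ga.
Qed.

Lemma equiv_has_class W W' u :
  has_class W u -> has_class W' u -> weight_equiv W W'.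
Proof.
move=> cW cW'; have [H [al [be [ga [tW tW' ga0 gaE]]]]] := has_class_eq cW cW'.
have [a0 ->] := twisted_equiv tW tW' ga0 gaE.
eexists; eexists; exists 1%g; split; last by [].
- exact: a0.
- by move=> g /=; case: ifP; rewrite ?oner_neq0.
- exact: aut_config1.
Qed.

(** The witnesses of plain equivalence already suffice: [ga] is unimodular because both factor sets
    are unitary, and [a] is a quotient of unimodular entries. *)
Lemma Hequiv_has_class W W' u : is_Hweight W -> is_Hweight W' ->
  has_class W u -> has_class W' u -> Hweight_equiv W W'.
Proof.
move=> hW hW' cW cW'.
have [H [al [be [ga [tW tW' ga0 gaE]]]]] := has_class_eq cW cW'.
have [_ W'E] := twisted_equiv tW tW' ga0 gaE.
have [ga1 gaV] := unitary_cochain (Hweight_unitary hW tW)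
  (Hweight_unitary hW' tW') ga0 gaE.
have n1 V (al' : {ffun [subg H] * [subg H] -> C}) x : is_Hweight V ->
    twisted V al' -> `|ent V (coset_rep H x) x| = 1.
  move=> [_ _ Vn _] tV; case: (Vn (coset_rep H x) x) => // /eqP.
  by rewrite normr_eq0 -[_ == 0]negbK tV.1 coset_coord_mem.
have gamma1 (g : gT) : `|if g \in H then ga (subg H g) else 1| = 1.
  by case: ifP; rewrite ?normr1.
eexists; eexists; exists 1%g; split; last exact: W'E.
- move=> x; rewrite normf_div normrM (n1 _ _ _ hW tW) (n1 _ _ _ hW' tW').
  by rewrite gamma1 mulr1 divr1.
- exact: gamma1.
(* Outside [H] the default value 1 of [gamma] is its own inverse. *)
- move=> g /=; rewrite groupV; case: ifP => gH; last by rewrite invr1.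
  by rewrite (morphV (subg_morphism H) gH) gaV.
- exact: aut_config1.
Qed.

Lemma Hweight_equivW W W' : Hweight_equiv W W' -> weight_equiv W W'.
Proof.
move=> [a [gamma [s [a1 gamma1 _ sG WE]]]]; exists a, gamma, s; split=> // x.
  by rewrite -normr_eq0 a1 oner_neq0.
by rewrite -normr_eq0 gamma1 oner_neq0.
Qed.

Lemma Hweight_weight W : is_Hweight W -> is_weight W.
Proof. by case. Qed.

Lemma weight_equivP W W' u u' :
  has_class W u -> has_class W' u' -> weight_equiv W W' <-> u = u'.
Proof.
move=> cW cW'; split; first exact: has_class_equiv cW cW'.
by move=> uu'; subst u'; exact: equiv_has_class cW cW'.
Qed.

Lemma Hweight_equivP W W' u u' : is_Hweight W -> is_Hweight W' ->
  has_class W u -> has_class W' u' -> Hweight_equiv W W' <-> u = u'.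
Proof.
move=> hW hW' cW cW'; split.
  by move=> /Hweight_equivW/(weight_equivP cW cW').
by move=> uu'; subst u'; exact: Hequiv_has_class cW cW'.
Qed.

(** Allows the class of a weight to serve as an invariant of H-weights when the first two sets are
    compared. *)
Lemma weight_class_eqP W W' : is_weight W -> is_weight W' ->
  weight_equiv W W' <-> weight_class W = weight_class W'.
Proof.
move=> wW wW'; have [u cW] := weight_has_class wW.
have [u' cW'] := weight_has_class wW'.
split=> [/(weight_equivP cW cW') uu'|e].
  subst u'; apply/seteqP.
  split=> V [wV EV]; split=> //; have [v cV] := weight_has_class wV.
    by apply/(weight_equivP cW' cV)/(weight_equivP cW cV).
  by apply/(weight_equivP cW cV)/(weight_equivP cW' cV).
have [//] : weight_class W W'.
by rewrite e; split=> //; apply/(weight_equivP cW' cW').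
Qed.

(** Since H-weights are weights, this one realization gives surjectivity for both kinds of
    classes. *)
Lemma bigH2_Hweight u : bigH2 u -> exists2 W, is_Hweight W & has_class W u.
Proof.
case: u => H X [al /Z2_unitary_rep[be [Zbe ube beal]] alX].
exists (factor_set_mx be); first exact: unitary_Hweight.
exists H, be; split; first exact: twisted_factor_set_mx.
by rewrite /tagged_class beal alX.
Qed.

End Classification.

Theorem theorem3p4 (R : realType) (gT : finGroupType) :
  exists (f21 : set 'M[R[i]]_#|gT| -> set 'M[R[i]]_#|gT|)
         (f13 f23 : set 'M[R[i]]_#|gT| -> tagged_classes R gT),
    [/\ set_bij (@Hweight_classes R gT) (@weight_classes R gT) f21
        /\ (forall W : 'M[R[i]]_#|gT|, is_Hweight W ->
              f21 (Hweight_class W) = weight_class W),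
        set_bij (@weight_classes R gT) (@bigH2 R gT) f13
        /\ (forall W : 'M[R[i]]_#|gT|, is_weight W ->
              exists (H : {group gT}) (al : {ffun [subg H] * [subg H] -> R[i]}),
                affords W al /\ f13 (weight_class W) = tagged_class al)
      & set_bij (@Hweight_classes R gT) (@bigH2 R gT) f23
        /\ (forall W : 'M[R[i]]_#|gT|, is_Hweight W ->
              exists (H : {group gT}) (al : {ffun [subg H] * [subg H] -> R[i]}),
                affords W al /\ f23 (Hweight_class W) = tagged_class al)].
Proof.
pose u0 : tagged_classes R gT := existT _ 1%G set0.
have hw := @Hweight_weight R gT.
have w_ex := @weight_has_class R gT.
have [f13 [bij13 f13E]] : exists f, set_bij (@weight_classes R gT) (@bigH2 R gT) f
    /\ forall W u, is_weight W -> has_class W u -> f (weight_class W) = u.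
  apply: class_bij => //.
  - by move=> W u _; exact: has_class_bigH2.
  - by move=> W W' u u' _ _; exact: weight_equivP.
  - by move=> u /bigH2_Hweight[W hW cW]; exists W => //; exact: hw.
have [f23 [bij23 f23E]] : exists f, set_bij (@Hweight_classes R gT) (@bigH2 R gT) f
    /\ forall W u, is_Hweight W -> has_class W u -> f (Hweight_class W) = u.
  apply: class_bij => //.
  - by move=> W /hw; exact: w_ex.
  - by move=> W u _; exact: has_class_bigH2.
  - exact: Hweight_equivP.
  - exact: bigH2_Hweight.
(* The invariant is now the weight class itself, so [f21] is induced by the inclusion of H-weights
   into weights. *)
have [f21 [bij21 f21E]] : exists f,
    set_bij (@Hweight_classes R gT) (@weight_classes R gT) f
    /\ forall W X, is_Hweight W -> weight_class W = X -> f (Hweight_class W) = X.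
  apply: class_bij; first exact: set0.
  - by move=> W _; exists (weight_class W).
  - by move=> W _ /hw wW <-; exists W.
  - move=> W W' _ _ hW hW' <- <-; have [u cW] := w_ex _ (hw _ hW).
    have [u' cW'] := w_ex _ (hw _ hW').
    rewrite (Hweight_equivP hW hW' cW cW').
    by rewrite -(weight_equivP cW cW') (weight_class_eqP (hw _ hW) (hw _ hW')).
  (* Every weight is equivalent to an H-weight, namely one realizing the same cohomology class. *)
  - move=> _ [W wW <-]; have [u cW] := w_ex _ wW.
    have [V hV cV] := bigH2_Hweight (has_class_bigH2 cW).
    exists V => //; apply/(weight_class_eqP (hw _ hV) wW).
    exact/(weight_equivP cV cW).
exists f21, f13, f23; split; split=> // W WW.
- exact: f21E.
- have [H [al tW]] := weight_twisted WW; exists H, al; split.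
    exact: twisted_affords tW.
  by apply: f13E => //; exists H, al.
- have [H [al tW]] := weight_twisted (hw _ WW); exists H, al; split.
    exact: twisted_affords tW.
  by apply: f23E => //; exists H, al.
Qed.
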